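(* Let $G$ be an infinite group with identity $e$ and let $G=A_1\cup\dots\cup A_m$. Then there exist $i\in\{1,\dots,m\}$, an injective sequence $(g_n)_{n\in\omega}$ in $G$ with $FP(g_n)_{n\in\omega}\subseteq A_i$, and a subset $X\subseteq FP(g_n)_{n\in\omega}$ such that $\Delta(X)=\{e\}\cup FP(g_n)_{n\in\omega}\cup(FP(g_n)_{n\in\omega})^{-1}$.
   Context: For $X\subseteq G$, $\Delta(X)=\{g\in G:|gX\cap X|=\infty\}$. For a sequence $(g_n)_{n\in\omega}$, $FP(g_n)_{n\in\omega}$ is the set of all products $g_{i_1}g_{i_2}\cdots g_{i_k}$ with $k\geqslant1$ and $i_1<i_2<\dots<i_k<\omega$. *)

(* Defs.v *)
From mathcomp Require Import all_boot.
From mathcomp Require Import boolp classical_sets functions cardinality.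

Set Implicit Arguments.
Unset Strict Implicit.
Unset Printing Implicit Defensive.

Local Open Scope classical_set_scope.
Local Open Scope group_scope.

Definition translate (G : groupType) (g : G) (X : set G) : set G :=
  [set g * x | x in X].

Definition Delta (G : groupType) (X : set G) : set G :=
  [set g | infinite_set (translate g X `&` X)].

(* The index list s is i_1 < ... < i_k with k >= 1; the group need not be
   commutative, and the product is taken in the order of s. *)
Definition FP (G : groupType) (g : nat -> G) : set G :=
  [set x | exists s : seq nat,
     [/\ s <> [::], sorted ltn s & x = \prod_(i <- s) g i]].

Definition set_inv (G : groupType) (X : set G) : set G :=
  [set x^-1 | x in X].

(* Main.v *)
(** The cofinite filter of [G] extends to a maximal filter [F] with
    [F <= F * F], and such an [F] is an idempotent ultrafilter [p].  Pick a
    cell [A i] in [p].  Galvin's argument chooses [g k] one after the other so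
    that all products stay in [A i]; since members of [p] are infinite, [g k]
    can moreover avoid any finite set, and we let it avoid every
    [a^-1 b c^-1 d] with [a, b, c, d] products of earlier terms (or [1]).

    Let [h k] run through the products of terms before [g k], taking each
    value infinitely often, and let [X] be the set of all [g k] and
    [h k * g k].  If [y = z x] with [x, y] in [X] of the same index, then [z]
    is [1], [h k] or its inverse.  Two pairs [(x, y)], [(x', y')] of mixed
    index with the same quotient [z] must have the same largest index, by the
    choice of the [g k], so each [z] comes from finitely many mixed pairs. *)
Require Import Defs.
From mathcomp Require Import all_boot.
From mathcomp Require Import boolp classical_sets functions cardinality.
From mathcomp Require Import filter.

Set Implicit Arguments.
Unset Strict Implicit.
Unset Printing Implicit Defensive.

Local Open Scope classical_set_scope.
Local Open Scope group_scope.

(** * Idempotent ultrafilters on a group *)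

(* For ultrafilters, this is the product of the semigroup [beta G]. *)
Definition filter_mul (G : groupType) (F H : set_system G) : set_system G :=
  [set A | F [set x | H [set y | A (x * y)]]].

Lemma filter_mulS (G : groupType) (F F' H H' : set_system G) :
  Filter F -> F `<=` F' -> H `<=` H' -> filter_mul F H `<=` filter_mul F' H'.
Proof.
move=> FF FF' HH' A FA; apply: FF'.
by apply: (@filterS _ F _ _ _ _ FA) => x; apply: HH'.
Qed.

Lemma filter_mulA (G : groupType) (F H K : set_system G) :
  filter_mul F (filter_mul H K) = filter_mul (filter_mul F H) K.
Proof.
apply/funext => A; rewrite /filter_mul /mkset; congr F; apply/funext => x.
by congr H; apply/funext => y; congr K; apply/funext => z; rewrite mulgA.
Qed.

Lemma filter_mul_proper (G : groupType) (F H : set_system G) :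
  ProperFilter F -> ProperFilter H -> ProperFilter (filter_mul F H).
Proof.
move=> FF HH; split; first move=> F0.
  apply: (filter_not_empty F); apply: (@filterS _ F _ _ _ _ F0) => x.
  exact: filter_not_empty.
split; rewrite /filter_mul /mkset.
- by apply: filterS filterT => x _; apply: filterT.
- by move=> A B FA FB; apply: filterS (filterI FA FB) => x [] /filterI; apply.
- by move=> A B AB; apply: filterS => x; apply: filterS => y; apply: AB.
Qed.

Definition cofinite (T : Type) : set_system T := [set A | cofinite_set A].
Arguments cofinite : clear implicits.

(** Inclusion passes to unions of chains, and for an ultrafilter it is already equality, by
    maximality. Containing all cofinite sets makes every member of [F] infinite. *)
Definition idem_filter (G : groupType) (F : set_system G) :=
  [/\ ProperFilter F, cofinite G `<=` F & F `<=` filter_mul F F].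

Lemma idem_filter_cofinite (G : groupType) :
  infinite_set [set: G] -> idem_filter (cofinite G).
Proof.
move=> Ginf; split=> //.
  split; first by rewrite /cofinite /mkset setC0.
  split; [exact: cofinite_setT | | exact: sub_cofinite_set].
  by move=> A B cA cB; rewrite /cofinite /mkset setCI finite_setU.
move=> A cA; rewrite /filter_mul /mkset.
apply: (@sub_cofinite_set _ [set: G]); last exact: cofinite_setT.
move=> x _ /=.
apply: (@finite_preimage _ _ (~` A) (fun y => x * y)) => //.
by move=> y z _ _; apply: mulgI.
Qed.

Lemma exists_max_idem_filter (G : groupType) : infinite_set [set: G] ->
  exists F : set_system G, idem_filter F /\
    forall H, idem_filter H -> F `<=` H -> H `<=` F.
Proof.
move=> Ginf; have cofI := idem_filter_cofinite Ginf.
(* The empty chain has empty union, which is not a filter; joining [cofinite G] repairs this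
   case. *)
pose P (S : set_system G) := idem_filter (S `|` cofinite G).
have [C CP Ctot|S [PS Smax]] := @Zorn_bigcup _ P; last first.
  exists (S `|` cofinite G); split=> // H HI SH A HA; apply: contrapT => SA.
  have [_ cH _] := HI.
  apply: (Smax H); last by rewrite /P (_ : H `|` _ = H) //; apply/setUidPl.
  split; last by move=> /(_ _ HA) ?; apply: SA; left.
  by move=> B SB; apply: SH; left.
set U := \bigcup_(S in C) S `|` cofinite G.
(* Directedness: any two members of [U] lie in one idempotent filter inside [U], where the axioms
   can be checked. *)
have dir A B : U A -> U B ->
    exists H, [/\ idem_filter H, H `<=` U, H A & H B].
  have SU S : C S -> S `|` cofinite G `<=` U.
    by move=> CS D [SD|]; [left; exists S | right].
  move=> [[S CS SA]|cA] [[T CT TB]|cB].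
  - have [ST|TS] := Ctot _ _ CS CT.
    + exists (T `|` cofinite G).
      by split; [exact: CP | exact: SU | left; exact: ST | left].
    + exists (S `|` cofinite G).
      by split; [exact: CP | exact: SU | left | left; exact: TS].
  - by exists (S `|` cofinite G); split;
      [exact: CP | exact: SU | left | right].
  - by exists (T `|` cofinite G); split;
      [exact: CP | exact: SU | right | left].
  - by exists (cofinite G); split=> // D; right.
split; last first.
- move=> A UA; have [H [[HP _ HH] HU HA _]] := dir _ _ UA UA.
  by apply: (filter_mulS _ HU HU); apply: HH.
- by move=> A; right.
split=> [U0|].
  by have [H [[HP _ _] _ + _]] := dir _ _ U0 U0; apply: filter_not_empty.
split; first by right; exact: cofinite_setT.
- move=> A B UA UB; have [H [[HP _ _] HU HA HB]] := dir _ _ UA UB.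
  exact: HU (filterI HA HB).
- move=> A B AB UA; have [H [[HP _ _] HU HA _]] := dir _ _ UA UA.
  by apply: HU; apply: filterS HA.
Qed.

Lemma ultra_filter_setC (T : Type) (p : set_system T) (A : set T) :
  UltraFilter p -> ~ p A -> p (~` A).
Proof. by move=> pU pA; case: (in_ultra_setVsetC A pU). Qed.

(* Papazyan's argument: for [p] an ultrafilter containing the maximal [F], both
   [F * p] and the filter generated by [F] and the sets [{x | x^-1 B \in p}]
   with [B] in [p] are idempotent, hence equal to [F]; so [p = F]. *)
Lemma idem_ultrafilter (G : groupType) : infinite_set [set: G] ->
  exists p : set_system G, UltraFilter p /\ idem_filter p.
Proof.
move=> Ginf; have [F [FI Fmax]] := exists_max_idem_filter Ginf.
have [FP cF FF] := FI; have [p [pU Fp]] := ultraFilterLemma FP.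
exists p; split=> //; have pP := ultra_proper.
have FFp : filter_mul F p `<=` F.
  apply: Fmax; last first.
    exact: subset_trans FF (filter_mulS _ (@subset_refl _ F) Fp).
  split; first exact: filter_mul_proper.
    apply: subset_trans cF (subset_trans FF _).
    exact: (filter_mulS _ (@subset_refl _ F) Fp).
  (* F * p * F * p contains F * p because F lies in F * F, hence in F * (p * F). *)
  have FpF : F `<=` filter_mul p F.
    by apply: subset_trans FF (filter_mulS _ Fp (@subset_refl _ F)).
  rewrite filter_mulA -(filter_mulA F p F).
  apply: filter_mulS => //; apply: subset_trans FF _.
  exact: filter_mulS.
pose D (B : set G) := [set x | p [set y | B (x * y)]].
have DI B B' : D (B `&` B') = D B `&` D B'.
  apply/seteqP; split=> x /=.
    by move=> pBB; split; apply: filterS pBB => y [].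
  by move=> [pB pB']; exact: filterI pB pB'.
pose H : set_system G := [set A | exists C B, [/\ F C, p B & C `&` D B `<=` A]].
have HF : H `<=` F.
  apply: Fmax; last first.
    by move=> C FC; exists C, setT; split; [| exact: filterT | move=> x []].
  split; last first.
  - move=> A [C [B [FC pB CBA]]].
    exists [set x | F [set y | C (x * y)]], B; split => //; first exact: FF.
    (* For [x] in [D B] the set x^-1 B is again in [p], and x^-1 (D B) = D (x^-1 B). *)
    move=> x [FCx Dx]; exists [set y | C (x * y)], [set y | B (x * y)].
    split=> // y [Cxy Bxy]; apply: CBA; split=> //.
    by apply: filterS Bxy => z /=; rewrite mulgA.
  - move=> C cC; exists C, setT; split; [exact: cF | exact: filterT | by move=> x []].
  split=> [[C [B [FC pB CB0]]]|].
    (* If [C] misses [D B], then x^-1 (~B) is in [p] for each [x] in [C], as [p] is ultra; so ~B is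
       in F * p, hence in [F] and in [p]. *)
    suff /FFp/Fp pB' : filter_mul F p (~` B).
      apply: (filter_not_empty p); apply: filterS (filterI pB pB').
      by move=> x [].
    apply: filterS FC => x Cx; apply: ultra_filter_setC => // Bx.
    by apply: (CB0 x).
  split.
  - by exists setT, setT; split; [exact: filterT | exact: filterT |].
  - move=> A A' [C [B [FC pB CBA]]] [C' [B' [FC' pB' CBA']]].
    exists (C `&` C'), (B `&` B'); split; [exact: filterI | exact: filterI |].
    by rewrite DI => x [[Cx C'x] [Bx B'x]]; split; [apply: CBA|apply: CBA'].
  - move=> A A' AA' [C [B [FC pB CBA]]]; exists C, B; split=> //.
    exact: subset_trans AA'.
suff pF : p `<=` F by rewrite (_ : p = F) //; apply/seteqP; split.
(* [F (D B)] says exactly that [B] is in F * p. *)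
move=> B pB; apply: FFp; apply: HF; exists setT, B.
by split; [exact: filterT | | move=> x []].
Qed.

(** * Galvin's choice of the sequence *)

Definition star (G : groupType) (p : set_system G) (A : set G) : set G :=
  A `&` [set x | p [set y | A (x * y)]].

Lemma star_in (G : groupType) (p : set_system G) (A : set G) :
  idem_filter p -> p A -> p (star p A).
Proof. by move=> [pP _ pp] pA; apply: filterI => //; exact: pp. Qed.

(** Idempotence is applied to x^-1 A, a member of [p]. Thus an element of [star p A] can be
    prolonged by [p]-almost every [y] and remains prolongable, which membership in [A] alone does
    not give. *)
Lemma star_translate (G : groupType) (p : set_system G) (A : set G) x :
  idem_filter p -> star p A x -> p [set y | star p A (x * y)].
Proof.
move=> [pP _ pp] [Ax pAx]; apply: filterS (filterI pAx (pp _ pAx)) => y [? pxy].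
by split=> //; apply: filterS pxy => z /=; rewrite mulgA.
Qed.

Lemma filter_all (T : Type) (I : eqType) (p : set_system T) (s : seq I)
    (B : I -> set T) : Filter p ->
  (forall i, i \in s -> p (B i)) -> p [set y | forall i, i \in s -> B i y].
Proof.
move=> pP; elim: s => [|i s IHs] ps; first by apply: filterS filterT.
have pi := ps i (mem_head i s).
have {}IHs := IHs (fun j js => ps j (mem_behead (s := i :: s) js)).
apply: filterS (filterI pi IHs) => y [Bi Bs] j.
by rewrite inE => /predU1P[->|/Bs].
Qed.

Definition avoids (G : groupType) (s : seq G) (y : G) :=
  {in s & s, forall a b, {in s & s, forall c d, a * y <> b * c^-1 * d}}.

Lemma sparse_extension (G : groupType) (p : set_system G) (A : set G)
    (s : seq G) :
  idem_filter p -> p A -> (forall a, a \in s -> a = 1 \/ star p A a) ->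
  exists y, (forall a, a \in s -> star p A (a * y)) /\
    avoids s y.
Proof.
move=> pI pA sA; have [pP cp _] := pI.
have p1 : p [set y | forall a, a \in s -> star p A (a * y)].
  apply: (@filter_all _ _ p s (fun a => [set y | star p A (a * y)])).
  move=> a /sA[->|]; last exact: star_translate.
  by apply: filterS (star_in pI pA) => y /=; rewrite mul1g.
pose bad := [seq a^-1 * v | a <- s, v <-
  [seq w * d | w <- [seq b * c^-1 | b <- s, c <- s], d <- s]].
have p2 : p (~` [set` bad]).
  by apply: cp; rewrite /cofinite /mkset setCK; exact: finite_seq.
have [y [sy ybad]] := filter_ex (filterI p1 p2).
exists y; split=> // a b sa sb c d sc sd ayE; apply: ybad.
rewrite /= -(mulKg a y) ayE.
by do 3?apply: allpairs_f.
Qed.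

(** Each list is a prefix of the next, so a position, once filled, names the same product at all
    later stages. *)
Fixpoint products (G : groupType) (g : nat -> G) (k : nat) : seq G :=
  if k is k'.+1
  then products g k' ++ [seq x * g k' | x <- products g k'] else [:: 1].

Definition sparse (G : groupType) (g : nat -> G) :=
  forall k, avoids (products g k) (g k).

Lemma sparse_sequence (G : groupType) (p : set_system G) (A : set G) :
  idem_filter p -> p A ->
  exists g : nat -> G,
    sparse g /\ forall k a, a \in products g k -> A (a * g k).
Proof.
move=> pI pA.
have /choice[f fP] : forall s, exists y,
    (forall a, a \in s -> a = 1 \/ star p A a) ->
    (forall a, a \in s -> star p A (a * y)) /\ avoids s y.
  move=> s; have [sA|sA] := pselect (forall a, a \in s -> a = 1 \/ star p A a).
    by have [y yP] := sparse_extension pI pA sA; exists y.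
  by exists 1.
(* [S] is to be [products g], but must be built before [g], whose terms are chosen from it. *)
pose S := fix S k := if k is k'.+1
  then S k' ++ [seq x * f (S k') | x <- S k'] else [:: 1].
pose g k := f (S k).
have SE k : products g k = S k by elim: k => //= k ->.
have SP k : forall a, a \in S k -> a = 1 \/ star p A a.
  elim: k => [|k IHk] a; first by rewrite inE => /eqP; left.
  rewrite mem_cat => /orP[/IHk //|/mapP[b bS ->]]; right.
  by have [+ _] := fP _ IHk; apply.
exists g; split=> [k|k a]; rewrite SE; first exact: (fP _ (SP k)).2.
by move=> /((fP _ (SP k)).1) [].
Qed.

(** * Finite products and their last factor *)

Lemma products1 (G : groupType) (g : nat -> G) k : 1 \in products g k.
Proof. by elim: k => [|k IHk]; rewrite ?inE //= mem_cat IHk. Qed.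

Lemma products_last (G : groupType) (g : nat -> G) k a :
  a \in products g k -> a * g k \in products g k.+1.
Proof.
by move=> ak; rewrite mem_cat (map_f (fun x => x * g k) ak) orbT.
Qed.

Lemma nth_products (G : groupType) (g : nat -> G) j k i :
  j <= k -> i < size (products g j) ->
  nth 1 (products g k) i = nth 1 (products g j) i.
Proof.
move=> /subnK <- ij; elim: (k - j) => //= d <-; rewrite nth_cat.
suff -> : i < size (products g (d + j)) by [].
by elim: d => //= d; rewrite size_cat => /leq_trans -> //; exact: leq_addr.
Qed.

Lemma products_sub (G : groupType) (g : nat -> G) j k :
  j <= k -> {subset products g j <= products g k}.
Proof.
move=> /subnK <-; elim: (k - j) => // d IHd a /IHd.
by rewrite addSn /= mem_cat => ->.
Qed.

Lemma mem_products (G : groupType) (g : nat -> G) k a :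
  a \in products g k <-> exists s : seq nat,
    [/\ sorted ltn s, all (gtn k) s & a = \prod_(i <- s) g i].
Proof.
elim: k a => [|k IHk] a.
  rewrite inE; split=> [/eqP->|[s [_ + ->]]].
    by exists [::]; rewrite big_nil.
  by case: s => //=; rewrite big_nil.
rewrite /= mem_cat; split.
  case/orP=> [/IHk[s [ss sk ->]]|/mapP[b /IHk[s [ss sk ->]] ->]].
    by exists s; split=> //; apply: sub_all sk => i /= /ltnW.
  exists (rcons s k); split.
  - move: ss; rewrite !(sorted_pairwise ltn_trans) pairwise_rcons => ->.
    by rewrite andbT.
  - rewrite all_rcons /= ltnSn /=; apply: sub_all sk => i /= /ltnW; exact.
  - by rewrite -cats1 big_cat big_seq1.
move=> [s]; case/lastP: s => [|s j] [].
  by move=> _ _ ->; rewrite big_nil products1.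
rewrite (sorted_pairwise ltn_trans) pairwise_rcons -(sorted_pairwise ltn_trans).
rewrite all_rcons /= ltnS leq_eqVlt => /andP[sj ss] /andP[jk sk] ->.
have [jE|jk'] := predU1P jk; last first.
  apply/orP; left; apply/IHk; exists (rcons s j); split=> //.
    rewrite (sorted_pairwise ltn_trans) pairwise_rcons.
    by rewrite -(sorted_pairwise ltn_trans) sj.
  by rewrite all_rcons /= jk'; apply: sub_all sj => i /= /ltn_trans ->.
apply/orP; right; rewrite -cats1 big_cat big_seq1 jE.
by apply: (map_f (fun x => x * g k)); apply/IHk; exists s; split=> //; rewrite -jE.
Qed.

(** Splitting off the factor of largest index gives the form to which [sparse] applies. *)
Lemma FP_products (G : groupType) (g : nat -> G) x :
  FP g x <-> exists k a, a \in products g k /\ x = a * g k.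
Proof.
split=> [[s [s0 ss ->]]|[k [a [/mem_products[s [ss sk ->]] ->]]]].
  case/lastP: s => [|s k] // in s0 ss *.
  exists k, (\prod_(i <- s) g i); split; last by rewrite -cats1 big_cat big_seq1.
  apply/mem_products; exists s; split=> //; move: ss.
    by rewrite !(sorted_pairwise ltn_trans) pairwise_rcons => /andP[].
  by rewrite !(sorted_pairwise ltn_trans) pairwise_rcons => /andP[].
exists (rcons s k); split; first by case: s {ss sk}.
  by rewrite (sorted_pairwise ltn_trans) pairwise_rcons -sorted_pairwise ?sk;
    [|exact: ltn_trans].
by rewrite -cats1 big_cat big_seq1.
Qed.

Lemma products_FP (G : groupType) (g : nat -> G) k a :
  a \in products g k -> a = 1 \/ FP g a.
Proof.
elim: k => [|k IHk]; first by rewrite inE => /eqP; left.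
rewrite mem_cat => /orP[/IHk //|/mapP[b bk ->]]; right.
by apply/FP_products; exists k, b.
Qed.

Lemma sparse_inj (G : groupType) (g : nat -> G) : sparse g -> injective g.
Proof.
move=> gP; suff lt j k : j < k -> g j <> g k.
  move=> j k gjk; have [/lt[]//|/lt[]//|//] := ltngtP j k.
move=> jk gjk; have gj : g j \in products g k.
  apply: (products_sub jk); rewrite -(mul1g (g j)).
  exact/products_last/products1.
have k1 := products1 g k.
(* [g j] is a forbidden value a^-1 b c^-1 d for [g k], with a = c = d = 1. *)
by apply: (gP k 1 (g j) k1 gj 1 1 k1 k1); rewrite invg1 !mulg1 mul1g.
Qed.

(** * A set with prescribed [Delta] *)

Lemma infinite_inj (T : Type) (f : nat -> T) (S : set T) :
  injective f -> (forall N, exists2 n, N <= n & S (f n)) -> infinite_set S.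
Proof.
move=> f_inj fS finS.
have finN : finite_set (f @^-1` S).
  by apply: finite_preimage finS => ? ? _ _; exact: f_inj.
have [s sE] := (finite_seqP _).1 finN.
have [n n_big Sn] := fS (\max_(i <- s) i).+1.
have sn : n \in s by move: (Sn : (f @^-1` S) n); rewrite sE.
by move: n_big; rewrite ltnNge (@leq_bigmax_seq _ s predT id n).
Qed.

Lemma recurrent_enumeration (G : groupType) (g : nat -> G) :
  exists h : nat -> G, (forall k, h k \in products g k) /\
    forall k a, a \in products g k -> forall N, exists2 n, N <= n & h n = a.
Proof.
(* [logn 2] takes each value infinitely often, and [products g k] is a prefix
   of [products g k.+1]. *)
exists (fun k => nth 1 (products g k) (logn 2 k)); split=> [k|k a ak N].
  have [?|?] := ltnP (logn 2 k) (size (products g k)); first exact: mem_nth.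
  by rewrite nth_default // products1.
pose i := index a (products g k).
have ik : i < size (products g k) by rewrite index_mem.
(* The odd cofactor makes the 2-adic valuation exactly [i] and pushes [n] beyond both [N] and [k],
   so that position [i] already holds [a]. *)
pose n := ((N + k).*2.+1 * 2 ^ i)%N.
have nNk : N + k <= n.
  by rewrite (leq_trans _ (leq_pmulr _ _)) ?expn_gt0 // -addnn -addnS leq_addr.
exists n; first exact: leq_trans (leq_addr _ _) nNk.
rewrite logn_Gauss ?coprime2n /= ?odd_double // pfactorK //.
rewrite (nth_products (leq_trans (leq_addl _ _) nNk) ik); exact: nth_index.
Qed.

Lemma Delta_sparse (G : groupType) (g : nat -> G) : sparse g ->
  exists2 X, X `<=` FP g & Delta X = [set 1] `|` FP g `|` set_inv (FP g).
Proof.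
move=> gP; have g_inj := sparse_inj gP.
have [h [hP h_rec]] := recurrent_enumeration g.
pose X := [set x | exists k, x = g k \/ x = h k * g k].
have Xg k : X (g k) by exists k; left.
have Xhg k : X (h k * g k) by exists k; right.
have XE x : X x -> exists k a, [/\ a = 1 \/ a = h k, a \in products g k &
    x = a * g k].
  case=> k [->|->]; exists k; last by exists (h k); split=> //; right.
  by exists 1; rewrite mul1g products1; split=> //; left.
have h_FP x : FP g x -> forall N, exists2 n, N <= n & h n = x.
  by case/FP_products=> k [a [/products_last /h_rec xP ->]].
exists X.
  by move=> x /XE[k [a [_ ak ->]]]; apply/FP_products; exists k, a.
(* If h n = x, then x carries [g n] to [h n * g n] and x^-1 carries it back; each x in [FP g] occurs
   for infinitely many [n]. *)
apply/seteqP; split=> [z zX|z]; last first.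
  case=> [[->|/h_FP zP]|[x /h_FP xP <-]].
  - apply: (infinite_inj g_inj) => N; exists N => //.
    by split=> //; exists (g N); rewrite ?mul1g.
  - apply: (@infinite_inj _ (fun n => z * g n)) => [m n /mulgI/g_inj //|N].
    have [n Nn <-] := zP N; exists n => //.
    by split=> //; exists (g n).
  - apply: (infinite_inj g_inj) => N; have [n Nn <-] := xP N; exists n => //.
    by split=> //; exists (h n * g n); rewrite ?mulKg.
apply: contrapT => zP.
pose cross k x y := exists j a b, [/\ j < k, a \in products g k,
  b \in products g j & (x = a * g k /\ y = b * g j) \/
    (y = a * g k /\ x = b * g j)].
have zcross x y : X x -> X y -> y = z * x -> exists k, cross k x y.
  case/XE=> j [a [aE aj ->]] /XE[k [b [bE bk ->]]] zE.
  have [jk|kj|jk] := ltngtP j k; first by exists k, j, b, a; split=> //; right.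
    by exists j, k, a, b; split=> //; left.
  (* With equal indices the factors [g j] cancel, leaving a quotient of two elements of {1, h j}. *)
  case: zP; rewrite -jk in bE bk zE.
  have {}zE : z = b * a^-1.
    by move: zE; rewrite mulgA => /mulIg ->; rewrite mulgK.
  have [h1|hF] := products_FP (hP j).
    by left; left; rewrite zE; case: aE => ->; case: bE => ->;
      rewrite ?h1 invg1 mulg1.
  case: aE zE => ->; case: bE => -> ->.
  - by left; left; rewrite invg1 mulg1.
  - by left; right; rewrite invg1 mulg1.
  - by right; exists (h j); rewrite ?mul1g.
  - by left; left; rewrite /= mulgV.
have cross_sub k x y : cross k x y -> forall l, k < l ->
    x \in products g l /\ y \in products g l.
  case=> j [a [b [jk ak bj xy]]] l kl.
  have ak' := products_sub kl (products_last ak).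
  have bj' := products_sub (ltn_trans jk kl) (products_last bj).
  by case: xy => [[-> ->]|[-> ->]].
(* Two cross pairs with distinct later indices are incompatible: the last
   [g l] would be expressible through four earlier products. *)
have cross_le k l x y x' y' : y = z * x -> y' = z * x' ->
    cross k x y -> cross l x' y' -> l <= k.
  move=> zxy zxy' ckl [j [a [b [jl al bj xy]]]]; rewrite leqNgt; apply/negP => kl.
  have [xl yl] := cross_sub _ _ _ ckl _ kl.
  have bl := products_sub jl (products_last bj).
  case: xy => -[aE bE].
    apply: (gP l a x al xl y (b * g j) yl bl).
    by rewrite -aE -bE zxy zxy' invgM !mulgA mulgV mul1g mulVg mul1g.
  apply: (gP l a y al yl x (b * g j) xl bl).
  by rewrite -aE -bE zxy zxy' mulgK.
(* The later index [k] of one cross pair bounds that of all others, so the whole intersection lies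
   in the finite list [products g k.+1]. *)
have [y0 [[x0 Xx0 xy0] Xy0]] := infinite_setN0 zX.
have [k ck] := zcross _ _ Xx0 Xy0 (esym xy0).
apply: zX; apply: (@sub_finite_set _ _ [set` products g k.+1]); last first.
  exact: finite_seq.
move=> y [[x Xx xy] Xy] /=; have [l cl] := zcross _ _ Xx Xy (esym xy).
have lk := cross_le _ _ _ _ _ _ (esym xy0) (esym xy) ck cl.
by have [] := cross_sub _ _ _ cl k.+1 lk.
Qed.

Theorem theorem5p2 (G : groupType) (m : nat) (A : 'I_m -> set G)
    (Ginf : infinite_set [set: G])
    (Acover : [set: G] = \bigcup_(i in [set: 'I_m]) A i) :
  exists (i : 'I_m) (g : nat -> G) (X : set G),
    [/\ injective g,
        FP g `<=` A i,
        X `<=` FP g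
      & Delta X = [set 1] `|` FP g `|` set_inv (FP g)].
Proof.
have [p [pU pI]] := idem_ultrafilter Ginf; have pP := ultra_proper.
have [i pAi] : exists i, p (A i).
  apply: contrapT => /forallNP pA.
  have pC : p [set x | forall i, i \in enum 'I_m -> (~` A i) x].
    by apply: filter_all => i _; apply: ultra_filter_setC.
  have [x xA] := filter_ex pC.
  have : [set: G] x by [].
  by rewrite Acover => -[i _]; apply: xA; rewrite mem_enum.
have [g [gP gA]] := sparse_sequence pI pAi.
have [X XFP DX] := Delta_sparse gP.
exists i, g, X; split=> //; first exact: sparse_inj.
by move=> x /FP_products[k [a [ak ->]]]; apply: gA.
Qed.
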